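(* Let $\theta>0$ and let $C_j^{\eta}(n)$ be the number of cycles of size $j$ in the playground game process $\eta^{n,\theta}$. For $2\le j\le n-2$, $$\mathbb{E}_\theta(C^{\eta}_{j}(n))=\frac{\theta\,(n-j+1)_{(j-2)}}{(\theta+n-j)_{(j-1)}}+\sum_{k=1}^{n-j-1}\frac{(-1)^{k+1}\theta^k(j-2)!}{(\theta+2)_{(j-3)}(\theta+j)_{(k)}}+\sum_{i=j+3}^{n-1}\sum_{k=1}^{n-i}\frac{(-\theta)^{k+1}(i-j)_{(j-2)}}{(\theta+i-j-1)_{(j-1)}(\theta+i-1)_{(k)}},$$ while $\mathbb{E}_\theta(C^{\eta}_{n}(n))=(n-2)!/(\theta+2)_{(n-3)}$ and $\mathbb{E}_\theta(C^{\eta}_{n-1}(n))=0$. For $j\ge 2$, $$\begin{aligned}\lim_{n\to\infty}\mathbb{E}(C^{\eta}_{j}(n))&=\int_0^1\int_0^1\frac{\theta^2e^{-\theta y}x^{\theta-1}(1-x)^{j-2}(1-y)^{\theta+j-1}}{(1-x+xy)^{j-1}}\,dx\,dy\\&\quad+\mathbf{1}\{j\ge 3\}\frac{\theta^3(j-2)!}{\theta_{(j+1)}}\left(\theta+j-1-\bigl((\theta+j-1)^2+j-1\bigr)\int_0^1 e^{-\theta x}(1-x)^{\theta+j}\,dx\right)\\&\quad-\mathbf{1}\{j=2\}\frac{\theta^2}{\theta+1}\int_0^1 e^{-\theta x}(1-x)^{\theta+2}\,dx.\end{aligned}$$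
   Context: Playground game process: fix $\theta>0$ and put $p_1=0$, $p_2=1$, $p_i=\frac{i-1}{i-1+\theta}$ for $i\ge 3$, $q_i=1-p_i$. For $n\ge 2$, $\eta=\eta^{n,\theta}=(\eta_{n+1}=1,\eta_n,\dots,\eta_1)$ is the $\{0,1\}$-valued inhomogeneous Markov chain, run in decreasing index and started from $\eta_{n+1}=1$, such that $\eta_n=0$ a.s., $\eta_1=1$ a.s., and for $2\le r\le n-1$: $\mathbb{P}(\eta_r=0\mid\eta_{r+1}=0)=p_r$, $\mathbb{P}(\eta_r=1\mid\eta_{r+1}=0)=q_r$, $\mathbb{P}(\eta_r=0\mid\eta_{r+1}=1)=1$. $C_j^{\eta}(n)$ is the number of $j$-spacings between consecutive $1$s in the sequence $(1,\eta_n,\dots,\eta_1)$, i.e. the number of occurrences of the pattern $1\,0^{j-1}\,1$. Notation: $x_{(m)}=x(x+1)\cdots(x+m-1)$ for $m\ge1$, with the conventions $x_{(0)}=x_{(-1)}=1$; empty sums are $0$. *)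

(* Defs.v *)
From HB Require Import structures.
From mathcomp Require Import all_boot all_order all_algebra.
From mathcomp Require Import all_classical all_reals all_analysis.
Import Order.TTheory GRing.Theory Num.Theory.
Import numFieldNormedType.Exports.

Set Implicit Arguments.
Unset Strict Implicit.
Unset Printing Implicit Defensive.

Local Open Scope classical_set_scope.
Local Open Scope ring_scope.

(* x_(m) = x (x + 1) ... (x + m - 1).  The index is an [int] because [m = -1]
   does occur, with x_(-1) = 1 by convention; other negative indices do not. *)
Definition rising (R : realType) (x : R) (m : int) : R :=
  match m with
  | Posz k => \prod_(i < k) (x + i%:R)
  | Negz _ => 1
  end.

(* Transition parameters; the value at index 0 is never used. *)
Definition pplay (R : realType) (theta : R) (i : nat) : R :=
  match i with
  | 0%N | 1%N => 0
  | 2%N => 1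
  | _ => (i.-1)%:R / ((i.-1)%:R + theta)
  end.

Definition qplay (R : realType) (theta : R) (i : nat) : R := 1 - pplay theta i.

(* P(A | B), meaningful only when P(B) != 0. *)
Definition cond_prob (d : measure_display) (T : measurableType d)
    (R : realType) (P : probability T R) (A B : set T) : R :=
  fine (P (A `&` B)) / fine (P B).

(* The states 1 and 0 are [true] and [false].  The chain is run in decreasing
   index from n + 1 down to 1; the variables [eta s] with [s = 0] or
   [s > n + 1] play no role. *)
Section Playground.
Context (d : measure_display) (T : measurableType d) (R : realType).
Variables (P : probability T R) (eta : nat -> {RV P >-> bool}).

Definition state (r : nat) (b : bool) : set T := [set w | eta r w = b].

(* The past of the chain before time r is e_{r+1}, ..., e_{n+1}. *)
Definition past (n r : nat) (e : nat -> bool) : set T :=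
  [set w | forall s, (r < s <= n.+1)%N -> eta s w = e s].

Record playground (theta : R) (n : nat) : Prop := Playground {
  playground_start : P (state n.+1 true) = 1%E;
  playground_second : P (state n false) = 1%E;
  playground_last : P (state 1 true) = 1%E;
  playground_markov : forall (r : nat) (e : nat -> bool), (1 <= r <= n)%N ->
    P (past n r e) != 0%E ->
    cond_prob P (state r (e r)) (past n r e) =
    cond_prob P (state r (e r)) (state r.+1 (e r.+1));
  playground_00 : forall r : nat, (2 <= r <= n.-1)%N ->
    P (state r.+1 false) != 0%E ->
    cond_prob P (state r false) (state r.+1 false) = pplay theta r;
  playground_01 : forall r : nat, (2 <= r <= n.-1)%N ->
    P (state r.+1 false) != 0%E ->
    cond_prob P (state r true) (state r.+1 false) = qplay theta r;
  playground_10 : forall r : nat, (2 <= r <= n.-1)%N ->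
    P (state r.+1 true) != 0%E ->
    cond_prob P (state r false) (state r.+1 true) = 1
}.

End Playground.

(* e_{r+j} ... e_r is the pattern 1 0^(j-1) 1. *)
Definition is_spacing (e : nat -> bool) (j r : nat) : bool :=
  [&& e (r + j)%N, all (fun s => ~~ e s) (iota r.+1 j.-1) & e r].

(* Number of j-spacings (j >= 1) in (e_{n+1}, ..., e_1). *)
Definition nspacings (n j : nat) (e : nat -> bool) : nat :=
  count (is_spacing e j) (iota 1 (n.+1 - j)).

(* C_j(n) as a real-valued function on the sample space. *)
Definition Ceta (d : measure_display) (T : measurableType d) (R : realType)
    (P : probability T R) (eta : nat -> {RV P >-> bool}) (n j : nat) : T -> R :=
  fun w => (nspacings n j (fun s => eta s w))%:R.

(* Main.v *)
(** Write u_r = P(eta_r = 1).  By the Markov property a j-spacing ending at r has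
    probability u_(r+j) g_r, where g_r depends on the transition parameters only
    and equals g_r = theta r_(j-2) / (theta+r-1)_(j-1) for r >= 3.  The recursion
    u_r = q_r (1 - u_(r+1)), u_n = 0, solved by an alternating sum, gives the
    formula for finite n.

    As n tends to infinity, u_r converges to
    w_r = theta int_0^1 e^(-theta y) (1-y)^(theta+r-2) dy, which satisfies the
    same recursion by integration by parts, with an error O(1 / (r n)); since
    g_r = O(1 / r), the expectation converges to g_1 w_(j+1) plus the sum of the
    g_r w_(r+j) over r >= 3.  Expanding (1 - x (1-y))^-(j-1) by the negative
    binomial series and integrating termwise, with Beta integrals in x, shows
    that the double integral is the same sum, with the closed form of g_r, taken
    over all r >= 1; the other terms of the limit account for r = 1, 2. *)

Require Import Defs.
From HB Require Import structures.
From mathcomp Require Import all_boot all_order all_algebra.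
From mathcomp Require Import all_classical all_reals all_analysis.
From mathcomp Require Import measurable_realfun.
From mathcomp Require Import zify ring.
Import Order.TTheory GRing.Theory Num.Theory.
Import numFieldNormedType.Exports.

Set Implicit Arguments.
Unset Strict Implicit.
Unset Printing Implicit Defensive.

Local Open Scope classical_set_scope.
Local Open Scope ring_scope.

(* The probability of the pattern 1 0^(j-1) 1 in r + j, ..., r, given that the
   state at time r + j is 1. *)
Definition gap (R : realType) (theta : R) (j r : nat) : R :=
  (\prod_(r.+1 <= m < (r + j).-1) pplay theta m)
    * (if r == 1%N then 1 else qplay theta r).

(** * Probabilities of path events and of spacings *)

Section Segments.
Context {d : measure_display} {T : measurableType d} {R : realType}.
Context (P : probability T R) (eta : nat -> {RV P >-> bool}).
Implicit Types (e : nat -> bool) (A B : set T).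

(** Convertible to [past] when the bounds are [r.+1] and [n.+1]; the free upper end allows paths
    that start below time [n.+1]. *)
Definition segment (r i : nat) (e : nat -> bool) : set T :=
  [set w | forall s, (r <= s <= i)%N -> eta s w = e s].

Lemma measurable_state r b : measurable (state eta r b).
Proof.
rewrite (_ : state eta r b = eta r @^-1` [set b]); last by apply/seteqP; split.
by apply: measurable_funPTI.
Qed.

Lemma measurable_segment r i e : measurable (segment r i e).
Proof.
rewrite (_ : segment r i e =
    \bigcap_(s in [set s | (r <= s <= i)%N]) state eta s (e s)).
  by apply: bigcap_measurableType => s _; exact: measurable_state.
by apply/seteqP; split.
Qed.

Lemma eq_segment r i e e' : (forall s, (r <= s <= i)%N -> e s = e' s) ->
  segment r i e = segment r i e'.
Proof.
by move=> ee'; apply/seteqP; split=> w h s hs; rewrite h// ee'.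
Qed.

Lemma segment1 r e : segment r r e = state eta r (e r).
Proof.
apply/seteqP; split=> w /= h; first by apply: h; rewrite leqnn.
by move=> s; rewrite -eqn_leq => /eqP <-.
Qed.

Lemma segment_recl r i e : (r <= i)%N ->
  segment r i e = state eta r (e r) `&` segment r.+1 i e.
Proof.
move=> ri; apply/seteqP; split=> [w h|w [h1 h2] s /andP[]].
  by split=> [|s /andP[rs si]]; apply: h; rewrite ?leqnn// (ltnW rs).
by rewrite leq_eqVlt => /predU1P[<- //|rs si]; apply: h2; rewrite rs.
Qed.

Lemma segment_recr r i e : (r <= i.+1)%N ->
  segment r i.+1 e = state eta i.+1 (e i.+1) `&` segment r i e.
Proof.
move=> ri; apply/seteqP; split=> [w h|w [h1 h2] s /andP[rs]].
  by split=> [|s /andP[rs si]]; apply: h; rewrite ?ri ?leqnn// rs ltnW.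
by rewrite leq_eqVlt => /predU1P[-> //|si]; apply: h2; rewrite rs.
Qed.

Definition pr A : R := fine (P A).

Lemma prE A : measurable A -> P A = (pr A)%:E.
Proof. by move=> mA; rewrite /pr fineK// fin_num_measure. Qed.

Lemma pr_ge0 A : 0 <= pr A.
Proof. by rewrite /pr fine_ge0. Qed.

Lemma le_pr A B : measurable A -> measurable B -> A `<=` B -> pr A <= pr B.
Proof.
move=> mA mB AB; rewrite -lee_fin -!prE//.
by apply: le_measure => //; rewrite inE.
Qed.

Lemma pr_splitC A B : measurable A -> measurable B ->
  pr B = pr (A `&` B) + pr (~` A `&` B).
Proof.
move=> mA mB; apply: EFin_inj.
have mC := measurableC mA.
rewrite EFinD -!prE; [|exact: measurableI..|by []].
rewrite -measureU; [|exact: measurableI..|].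
  by rewrite -setIUl setUv setTI.
by rewrite setIACA setICr set0I.
Qed.

Lemma state_setC r b : ~` state eta r b = state eta r (~~ b).
Proof.
by apply/seteqP; split=> w /=; rewrite /state/=; case: (eta r w) b => -[].
Qed.

Lemma pr_state_split r b B : measurable B ->
  pr B = pr (state eta r b `&` B) + pr (state eta r (~~ b) `&` B).
Proof.
by move=> mB; rewrite -state_setC -pr_splitC//; exact: measurable_state.
Qed.

Lemma pr_stateN r b : pr (state eta r (~~ b)) = 1 - pr (state eta r b).
Proof.
have := pr_state_split r b measurableT.
by rewrite !setIT /pr probability_setT/= => ->; rewrite addrAC subrr add0r.
Qed.

Lemma pr_sure r b c B : measurable B -> P (state eta r b) = 1%E ->
  pr (state eta r c `&` B) = pr B * (c == b)%:R.
Proof.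
move=> mB Pb; have mS := measurable_state r.
have N0 : pr (state eta r (~~ b) `&` B) = 0.
  apply/eqP; rewrite eq_le pr_ge0 andbT.
  have -> : 0 = pr (state eta r (~~ b)) by rewrite pr_stateN /pr Pb subrr.
  by apply: le_pr; [exact: measurableI|exact: mS|exact: subIsetl].
have [->|/negPf] := eqVneq c b.
  by rewrite mulr1 (pr_state_split r b mB) N0 addr0.
by move: N0; case: b {Pb}; case: c => //= -> _; rewrite mulr0.
Qed.

Definition spacing_event (j r : nat) : set T :=
  [set w | is_spacing (fun s => eta s w) j r].

(** Prescribing all states from [r] to [r + j] turns a spacing into a path event, to which the
    Markov steps apply. *)
Lemma spacing_eventE j r : (1 <= j)%N ->
  spacing_event j r =
  segment r (r + j) (fun s => (s == r) || (s == r + j)%N).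
Proof.
move=> j1; apply/seteqP; split=> w.
  move=> /and3P[top /allP mid bot] s /andP[rs sj].
  have [->//|sr] := eqVneq s r; have [->//|srj /=] := eqVneq s (r + j)%N.
  by apply/negbTE/mid; rewrite mem_iota; lia.
move=> h; apply/and3P; split.
- by rewrite h ?eqxx ?orbT//; lia.
- apply/allP => s; rewrite mem_iota => hs; rewrite h; last lia.
  by rewrite negb_or; apply/andP; split; lia.
- by rewrite h ?eqxx//; lia.
Qed.

Lemma measurable_spacing_event j r : (1 <= j)%N -> measurable (spacing_event j r).
Proof. by move=> j1; rewrite spacing_eventE//; exact: measurable_segment. Qed.

Lemma expectation_Ceta n j : (1 <= j)%N ->
  'E_P[Ceta eta n j]%E =
  (\sum_(1 <= r < (n.+2 - j)%N) pr (spacing_event j r))%:E.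
Proof.
move=> j1; rewrite unlock.
transitivity (\int[P]_w (\sum_(r <- index_iota 1 (n.+2 - j))
    (\1_(spacing_event j r) w)%:E))%E.
  apply: eq_integral => w _; rewrite sumEFin; congr _%:E.
  rewrite /Ceta /nspacings -sum1_count natr_sum [LHS]big_mkcond /=.
  rewrite /index_iota (_ : n.+2 - j - 1 = n.+1 - j)%N; last lia.
  apply: eq_bigr => r _; rewrite indicE.
  have -> : (w \in spacing_event j r) = is_spacing (fun s => eta s w) j r.
    by apply/idP/idP; rewrite inE.
  by case: ifP.
have mE r := measurable_spacing_event r j1.
rewrite ge0_integral_sum//; last first.
  by move=> r; apply/measurable_EFinP; exact: measurable_indic.
rewrite -sumEFin; apply: eq_bigr => r _.
by rewrite integral_indic// setIT; exact: prE.
Qed.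


(** Probability of state [b] at time [r] given state [a] at time [r.+1]. Including the forced states
    at times [n] and [1] lets one formula cover every step. *)
Definition kernel (theta : R) n r (a b : bool) : R :=
  if r == n then (~~ b)%:R
  else if r == 1%N then b%:R
  else if a then (~~ b)%:R else if b then qplay theta r else pplay theta r.

Section Step.
Context {theta : R} {n : nat}.
Hypotheses (n2 : (2 <= n)%N) (Hp : playground eta theta n).

Lemma cond_prob_state r a b : (2 <= r <= n.-1)%N ->
  P (state eta r.+1 a) != 0%E ->
  cond_prob P (state eta r b) (state eta r.+1 a) = kernel theta n r a b.
Proof.
move=> /andP[r2 rn] Pa; rewrite /kernel.
rewrite ltn_eqF; last by rewrite (leq_ltn_trans rn)// ltn_predL (ltnW n2).
rewrite gtn_eqF//.
have rr : (2 <= r <= n.-1)%N by rewrite r2.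
case: a b Pa => -[] Pa.
(* The transition from 1 to 1 is not prescribed; it has probability 0 because the one from 1 to 0
   has probability 1. *)
- have := playground_10 Hp rr Pa; rewrite /cond_prob.
  have mS := measurable_state r.+1 true.
  have Pa0 : pr (state eta r.+1 true) != 0.
    by apply: contra Pa => /eqP Pa; rewrite prE// Pa.
  rewrite -/(pr _) -/(pr (state eta r.+1 true)) => /(canRL (divfK Pa0)).
  rewrite mul1r => E; have := pr_state_split r false mS; rewrite E.
  move/eqP; rewrite -subr_eq0 opprD addrA subrr add0r oppr_eq0 => /eqP.
  by rewrite /pr => ->; rewrite mul0r.
- exact: (playground_10 Hp rr Pa).
- exact: (playground_01 Hp rr Pa).
- exact: (playground_00 Hp rr Pa).
Qed.

(** In product form the Markov property extends to null pasts, where both sides vanish. Times [n]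
    and [1] are handled by their sure states. *)
Lemma pr_past_step r e : (1 <= r <= n)%N ->
  pr (segment r n.+1 e) = pr (segment r.+1 n.+1 e) * kernel theta n r (e r.+1) (e r).
Proof.
move=> /andP[r1 rn]; have mS := measurable_segment r.+1 n.+1 e.
rewrite segment_recl; last exact: leqW.
have [rEn|rn'] := eqVneq r n.
  rewrite (pr_sure _ mS (b := false)); last by rewrite rEn; exact: playground_second Hp.
  by rewrite /kernel rEn eqxx; case: (e n).
have [rE1|r1'] := eqVneq r 1%N.
  rewrite (pr_sure _ mS (b := true)); last by rewrite rE1; exact: playground_last Hp.
  by rewrite /kernel (negPf rn') rE1 eqxx; case: (e 1%N).
have [S0|S0] := eqVneq (P (segment r.+1 n.+1 e)) 0%E.
  have S0' : pr (segment r.+1 n.+1 e) = 0 by rewrite /pr S0.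
  rewrite S0' mul0r; apply/eqP; rewrite eq_le pr_ge0 -S0' andbT.
  apply: le_pr; [|exact: mS|exact: subIsetr].
  by apply: measurableI => //; exact: measurable_state.
have S0' : pr (segment r.+1 n.+1 e) != 0.
  by apply: contra S0 => /eqP S0; rewrite prE// S0.
have := @playground_markov _ _ _ _ _ _ _ Hp r e.
rewrite r1 rn => /(_ isT S0) E.
have {}E : cond_prob P (state eta r (e r)) (segment r.+1 n.+1 e) =
  kernel theta n r (e r.+1) (e r).
  rewrite -cond_prob_state//; first by lia.
  have mS' := measurable_state r.+1 (e r.+1).
  apply: contra S0' => /eqP S0'; rewrite eq_le pr_ge0 andbT.
  have <- : pr (state eta r.+1 (e r.+1)) = 0 by rewrite /pr S0'.
  apply: le_pr => // w; apply; rewrite leqnn/=; exact: rn.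
by move: E; rewrite /cond_prob => /(canRL (divfK S0')); rewrite mulrC.
Qed.

(* Marginalising the Markov property over the states above time i. *)
Lemma pr_segment_step r i e : (1 <= r < i)%N -> (i <= n.+1)%N ->
  pr (segment r i e) = pr (segment r.+1 i e) * kernel theta n r (e r.+1) (e r).
Proof.
move=> /andP[r1 ri] iN; rewrite -(subKn iN); set m := (n.+1 - i)%N.
have : (m <= n - r)%N.
  by lia.
elim: m e => [|m IH] e mn.
  rewrite subn0; apply: pr_past_step; rewrite r1/=.
  by rewrite -ltnS (leq_trans ri).
have rn : (r <= n)%N by rewrite -ltnS (leq_trans ri).
set k := (n.+1 - m.+1)%N in IH *.
have kE : (n.+1 - m)%N = k.+1.
  by lia.
have rk : (r < k)%N by lia.
rewrite kE in IH.
rewrite (@pr_state_split k.+1 true (segment r k e)); last exact: measurable_segment.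
rewrite (@pr_state_split k.+1 true (segment r.+1 k e)); last exact: measurable_segment.
(* The induction hypothesis, which has upper end [k.+1], is applied to the path overwritten at
   [k.+1]; its values at [r] and [r.+1] are unchanged since [r < k]. *)
pose e' b s := if s == k.+1 then b else e s.
have E b l : (l <= k)%N ->
    state eta k.+1 b `&` segment l k e = segment l k.+1 (e' b).
  move=> lk; rewrite segment_recr ?leqW// /e' eqxx; congr (_ `&` _).
  by apply: eq_segment => s /andP[_ sk]; rewrite ltn_eqF.
rewrite !E//; last exact: ltnW.
rewrite !IH; [|exact: ltnW..]. 
rewrite /e' !ltn_eqF//; last by rewrite ltnS ltnW.
  by rewrite mulrDl.
exact: ltnW.
Qed.


Lemma pr_state_start : pr (state eta n.+1 true) = 1.
Proof. by rewrite /pr (playground_start Hp). Qed.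

Lemma pr_state_second : pr (state eta n true) = 0.
Proof.
by rewrite [LHS](pr_stateN n false) /pr (playground_second Hp) subrr.
Qed.

(** Total probability over the state at [r.+1], where a 1 forbids a 1 at [r]. *)
Lemma pr_state_rec r : (2 <= r <= n.-1)%N ->
  pr (state eta r true) = qplay theta r * (1 - pr (state eta r.+1 true)).
Proof.
move=> rn; have mS b := measurable_state r b.
have step b : pr (state eta r.+1 b `&` state eta r true) =
    pr (state eta r.+1 b) * kernel theta n r b true.
  pose e s := if s == r then true else b.
  have er : e r = true by rewrite /e eqxx.
  have er1 : e r.+1 = b by rewrite /e gtn_eqF.
  have := @pr_segment_step r r.+1 e.
  rewrite segment_recl ?leqnSn// segment1 setIC er er1.
  by apply; lia.
rewrite (pr_state_split r.+1 true)// !step pr_stateN /kernel.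
rewrite ltn_eqF; last by lia.
by rewrite gtn_eqF; [rewrite mulr0 add0r mulrC|lia].
Qed.

(** Descending from the top 1, the first 0 is certain, the other [j - 2] zeros contribute factors
    [pplay], and the final 1 contributes [qplay], or 1 at the sure time 1. *)
Lemma pr_spacing j r : (2 <= j)%N -> (1 <= r)%N -> (r + j <= n.+1)%N ->
  pr (spacing_event j r) = pr (state eta (r + j) true) * gap theta j r.
Proof.
move=> j2 r1 rj; rewrite spacing_eventE; last exact: ltnW.
set e := fun _ => _; have erj : e (r + j)%N by rewrite /e eqxx orbT.
have e0 s : (r < s < r + j)%N -> e s = false by rewrite /e; lia.
have top : pr (segment (r + j).-1 (r + j) e) = pr (state eta (r + j) true).
  rewrite pr_segment_step; [|lia|by []].
  rewrite prednK ?segment1 ?erj; last lia.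
  rewrite e0; last lia.
  rewrite /kernel; case: ifP => _; first by rewrite mulr1.
  by rewrite ifF ?mulr1//; lia.
have mid k : (k <= j - 2)%N -> pr (segment ((r + j).-1 - k) (r + j) e) =
    pr (state eta (r + j) true) * \prod_((r + j).-1 - k <= m < (r + j).-1) pplay theta m.
  elim: k => [|k IH] kj; first by rewrite subn0 big_geq ?mulr1.
  rewrite pr_segment_step; [|lia|by []].
  have -> : ((r + j).-1 - k.+1).+1 = ((r + j).-1 - k)%N by lia.
  rewrite IH; last lia.
  rewrite (@big_ltn _ _ _ ((r + j).-1 - k.+1)%N); last lia.
  have -> : ((r + j).-1 - k.+1).+1 = ((r + j).-1 - k)%N by lia.
  rewrite !e0; [|lia..].
  rewrite /kernel ifF; last lia.
  by rewrite ifF; [ring|lia].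
rewrite pr_segment_step; [|lia|by []].
have := mid (j - 2)%N (leqnn _).
have -> : ((r + j).-1 - (j - 2))%N = r.+1 by lia.
move=> ->; rewrite -mulrA /gap; congr (_ * (_ * _)).
rewrite e0; last lia.
rewrite /e eqxx/= /kernel ifF; last lia.
by case: ifP.
Qed.

End Step.
End Segments.

Local Arguments rising : simpl never.

(** * Formula for finite n *)

Section Rising.
Context {R : realType}.
Implicit Types x : R.

Lemma rising0 x : rising x 0%N = 1.
Proof. by rewrite /rising big_ord0. Qed.

Lemma risingS x k : rising x k.+1 = x * rising (x + 1) k.
Proof.
rewrite /rising big_ord_recl addr0; congr (_ * _).
by apply: eq_bigr => i _; rewrite lift0 -addrA -nat1r.
Qed.

Lemma risingSr x k : rising x k.+1 = rising x k * (x + k%:R).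
Proof. by rewrite /rising big_ord_recr. Qed.

Lemma rising_gt0 x (m : int) : 0 < x -> 0 < rising x m.
Proof.
by case: m => //= k x0; apply: prodr_gt0 => i _; rewrite ltr_wpDr.
Qed.

Lemma le_rising x y k : 0 <= x -> x <= y -> rising x k%:Z <= rising y k%:Z.
Proof.
move=> x0 xy; apply: ler_prod => i _; by rewrite addr_ge0//= lerD2r.
Qed.

Lemma rising_fact r k : rising r.+1%:R k%:Z = (r + k)`!%:R / r`!%:R :> R.
Proof.
elim: k r => [|k IH] r.
  by rewrite rising0 addn0 divff// pnatr_eq0 -lt0n fact_gt0.
rewrite risingSr IH addnS factS natrM -natrD addSn mulrC; ring.
Qed.

End Rising.

Section PlaygroundFormula.
Context {R : realType} (theta : R).
Hypothesis theta_gt0 : 0 < theta.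

(** The value of P(eta_r = 1) for r >= 3, with m = n - r and a = theta + r - 1. *)
Definition altsum (m : nat) (a : R) : R :=
  \sum_(1 <= k < m.+1) (-1) ^+ k.+1 * theta ^+ k / rising a k%:Z.

Lemma altsum0 (a : R) : altsum 0 a = 0.
Proof. by rewrite /altsum big_geq. Qed.

(** Peeling off the first term and using a_(k+1) = a (a+1)_(k) reproduces the recursion of the u_r,
    as q_r = theta / a for r >= 3. *)
Lemma altsumS m (a : R) : 0 < a ->
  altsum m.+1 a = theta / a * (1 - altsum m (a + 1)).
Proof.
move=> a0; rewrite /altsum big_ltn// big_add1/= mulrBr mulr1; congr (_ + _).
  by rewrite risingS rising0 !mulr1 sqrrN expr1n mul1r expr1.
rewrite mulr_sumr -sumrN; apply: eq_bigr => k _.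
have ak := rising_gt0 k (addr_gt0 a0 ltr01).
by rewrite risingS !exprS; field; rewrite (lt0r_neq0 ak) (lt0r_neq0 a0).
Qed.

(** The closed form of [gap] for [r >= 3]. At [r = 1, 2] it can differ from [gap], but these values
    also occur in the series of the double integral. *)
Definition gap_rate (j r : nat) : R :=
  theta * rising r%:R (j%:Z - 2) / rising (theta + (r - 1)%N%:R) (j%:Z - 1).

Lemma qplay3 r : (3 <= r)%N -> qplay theta r = theta / (theta + (r - 1)%N%:R).
Proof.
case: r => [|[|[|r]]]// _; rewrite /qplay/= subn1/=.
by field; rewrite lt0r_neq0// ltr_wpDr// addr_ge0.
Qed.

Lemma prod_pplay r k : (2 <= r)%N ->
  \prod_(r.+1 <= m < r.+1 + k) pplay theta m
  = rising r%:R k%:Z / rising (theta + r%:R) k%:Z.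
Proof.
move=> r2; elim: k => [|k IH].
  by rewrite addn0 big_geq// !rising0 divr1.
rewrite addnS big_nat_recr ?leq_addr//= IH !risingSr -[in RHS]mulf_div.
congr (_ * _); rewrite -addrA -natrD.
by case: r r2 {IH} => [|[|r]]// _; rewrite addrC.
Qed.

Lemma gap_rateE j r : (2 <= j)%N -> (3 <= r)%N -> gap theta j r = gap_rate j r.
Proof.
case: j => [|[|k]]// _ r3; rewrite /gap /gap_rate.
have -> : (r + k.+2).-1 = (r.+1 + k)%N by lia.
rewrite prod_pplay ?(ltnW r3)// ifF; last lia.
have -> : (k.+2%:Z - 2 = k)%R by lia.
have -> : (k.+2%:Z - 1 = k.+1)%R by lia.
have E : theta + (r - 1)%:R + 1 = theta + r%:R.
  by rewrite -addrA natr1; congr (_ + _%:R); lia.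
rewrite qplay3// risingS E.
have tr : 0 < theta + r%:R by rewrite ltr_wpDr.
have tr1 : 0 < theta + (r - 1)%:R by rewrite ltr_wpDr.
have kk := rising_gt0 k tr.
by field; rewrite (lt0r_neq0 kk) (lt0r_neq0 tr1).
Qed.

(** The end at time 1 costs no factor q, and p_2 = 1 drops out, so the product starts at p_3. For
    [j = 2] the product is empty and the index is -1. *)
Lemma gap1 j : (2 <= j)%N ->
  gap theta j 1 = (j - 2)`!%:R / rising (theta + 2) (j%:Z - 3).
Proof.
case: j => [|[|[|k]]]// _; rewrite /gap eqxx mulr1.
  by rewrite big_geq//= invr1 mulr1 .
rewrite add1n/= big_ltn//= mul1r.
have := prod_pplay k (leqnn 2); rewrite -[(3 + k)%N]/(k.+3) => ->.
have -> : (k.+3%:Z - 3 = k)%R by lia.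
by rewrite (rising_fact 1) divr1 subSS subSS subn0 add1n.
Qed.

Lemma gap2 j : gap theta j 2 = 0.
Proof. by rewrite /gap /= /qplay/= subrr mulr0. Qed.

Section Expectation.
Context {d : measure_display} {T : measurableType d}.
Context {P : probability T R} {eta : nat -> {RV P >-> bool}} {n : nat}.
Local Notation pr := (pr P).
Hypotheses (n2 : (2 <= n)%N) (Hp : playground eta theta n).

(** Backward induction from u_n = 0. It stops at [r = 3], as q_2 = 0 is not of the form theta /
    (theta + r - 1). *)
Lemma pr_state_altsum r : (3 <= r <= n)%N ->
  pr (state eta r true) = altsum (n - r) (theta + (r - 1)%N%:R).
Proof.
move=> /andP[r3 rn]; rewrite -(subKn rn); set m := (n - r)%N.
have : (m <= n - 3)%N by lia.
elim: m => [|m IH] mn.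
  by rewrite subn0 subnn altsum0 (pr_state_second Hp).
rewrite (pr_state_rec n2 Hp); last lia.
have -> : (n - m.+1).+1 = (n - m)%N by lia.
rewrite IH; last lia.
have -> : (n - (n - m.+1) = m.+1)%N by lia.
have -> : (n - (n - m) = m)%N by lia.
rewrite altsumS; last by rewrite ltr_wpDr.
rewrite qplay3; last lia.
by rewrite -addrA natr1; congr (_ * (1 - altsum _ (_ + _%:R))); lia.
Qed.

(** Among the end positions 1 to n - j + 1, the last has its top at the sure 1 at time n + 1, n - j
    vanishes as u_n = 0, and 2 vanishes as q_2 = 0. *)
Lemma expectation_gap_sum j : (2 <= j <= n - 2)%N ->
  'E_P[Ceta eta n j]%E =
  (gap_rate j (n - j + 1) + gap theta j 1 * altsum (n - j - 1) (theta + j%:R)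
   + \sum_(3 <= r < n - j)
       gap_rate j r * altsum (n - (r + j)) (theta + (r + j - 1)%N%:R))%:E.
Proof.
move=> jn; rewrite expectation_Ceta; last lia.
congr _%:E; rewrite big_ltn; last lia.
have -> : (n.+2 - j = (n - j).+2)%N by lia.
rewrite !big_nat_recr/=; [|lia..].
have spE r : (1 <= r < (n - j).+2)%N ->
    pr (spacing_event eta j r) = pr (state eta (r + j) true) * gap theta j r.
  by move=> hr; rewrite (pr_spacing n2 Hp)//; lia.
rewrite !spE; [|lia..].
have -> : (n - j + j = n)%N by lia.
have -> : ((n - j).+1 + j = n.+1)%N by lia.
rewrite (pr_state_second Hp) (pr_state_start Hp) mul0r addr0 mul1r.
rewrite pr_state_altsum; last lia.
rewrite [gap _ _ (n - j).+1]gap_rateE; [|lia..].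
rewrite addn1 addrA addrC !addrA mulrC; congr (_ + _ * altsum _ (_ + _%:R) + _).
- by lia.
- by lia.
case: (leqP (n - j) 2) => nj; first by rewrite !big_geq//; lia.
rewrite big_ltn// spE; last lia.
rewrite gap2 mulr0 add0r; apply: eq_big_nat => r /andP[r3 rn].
rewrite spE; last lia.
by rewrite gap_rateE; [|lia..]; rewrite mulrC pr_state_altsum//; lia.
Qed.

Lemma expectation_explicit j : (2 <= j <= n - 2)%N ->
  'E_P[Ceta eta n j]%E =
  (theta * rising (n - j + 1)%N%:R (j%:Z - 2)
     / rising (theta + (n - j)%N%:R) (j%:Z - 1)
   + \sum_(1 <= k < n - j)
       (-1) ^+ k.+1 * theta ^+ k * ((j - 2)`!)%:R
         / (rising (theta + 2) (j%:Z - 3)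
            * rising (theta + j%:R) k%:Z)
   + \sum_(j + 3 <= i < n) \sum_(1 <= k < (n - i).+1)
       (- theta) ^+ k.+1 * rising (i - j)%N%:R (j%:Z - 2)
         / (rising (theta + (i - j - 1)%N%:R) (j%:Z - 1)
            * rising (theta + (i - 1)%N%:R) k%:Z))%:E.
Proof.
move=> jn; rewrite expectation_gap_sum//; congr (_ + _ + _)%:E.
- by rewrite /gap_rate addnK.
- rewrite gap1 ?mulr_sumr; last lia.
  have -> : (n - j - 1).+1 = (n - j)%N by lia.
  apply: eq_bigr => k _.
  by rewrite invfM; ring.
(* Substitution i = r + j; the theta of [gap_rate] and the signed powers in [altsum] combine into (-
   theta)^(k+1). *)
rewrite addnC big_addn; apply: eq_big_nat => r /andP[r3 rn].
rewrite mulr_sumr addnK; apply: eq_bigr => k _.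
rewrite /gap_rate invfM [(- theta) ^+ _]exprNn !exprS.
by ring.
Qed.

Lemma expectation_full : 'E_P[Ceta eta n n]%E =
  (((n - 2)`!)%:R / rising (theta + 2) (n%:Z - 3))%:E.
Proof.
rewrite expectation_Ceta ?(ltnW n2)//.
have -> : (n.+2 - n = 2)%N by lia.
rewrite big_nat1 (pr_spacing n2 Hp)// (pr_state_start Hp) mul1r.
by rewrite gap1.
Qed.

(** A spacing ending at 1 needs a 1 at time n, one ending at 2 needs a 1 at time 2, and both states
    are null. *)
Lemma expectation_none : 'E_P[Ceta eta n (n - 1)]%E = 0%:E.
Proof.
rewrite expectation_Ceta; last lia.
have -> : (n.+2 - (n - 1) = 3)%N by lia.
rewrite big_ltn// big_nat1.
have ev0 r s : (s = r) \/ (s = r + (n - 1))%N -> pr (state eta s true) = 0 ->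
    pr (spacing_event eta (n - 1) r) = 0.
  move=> sr s0; apply/eqP; rewrite eq_le pr_ge0 andbT -s0 le_pr//.
  - by apply: measurable_spacing_event; lia.
  - exact: measurable_state.
  - by move=> w /and3P[top _ bot]; case: sr => ->.
rewrite (ev0 1%N n); [|by right; lia|exact: pr_state_second Hp].
rewrite (ev0 2%N 2%N) ?addr0//; first by left.
have [nE|n3] := eqVneq n 2%N; first by rewrite -nE (pr_state_second Hp).
by rewrite (pr_state_rec n2 Hp) /qplay/= ?subrr ?mul0r//; lia.
Qed.

End Expectation.
End PlaygroundFormula.

(** * Integrals *)

Section ExpIntegral.
Context {R : realType}.
Local Notation mu := (@lebesgue_measure R).
Implicit Types a x y : R.

Lemma is_derive_onem_powR a y : y < 1 ->
  is_derive y 1 (fun y => (1 - y) `^ a) (- (a * (1 - y) `^ (a - 1))).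
Proof.
move=> y1; have d1 : is_derive y 1 (fun y : R => 1 - y) (- 1).
  by apply: is_derive_eq; rewrite add0r mul1r.
have := is_derive1_comp (f := fun x => x `^ a) (g := fun y : R => 1 - y)
  (is_derive1_powR a _) d1.
rewrite subr_gt0 => /(_ y1).
by rewrite mulrN1.
Qed.

Lemma cvg_onem_left : (1 - y : R) @[y --> (1:R)^'-] --> (0:R)^'+.
Proof.
move=> A [e /= e0 eA]; exists e => //= y.
rewrite /ball_/= => y1 ylt; apply: eA; last by rewrite /= subr_gt0.
by rewrite /ball_/= sub0r normrN.
Qed.

(** For [a < 1] the derivative may blow up at 1, so only one-sided continuity is claimed at the
    ends. *)
Lemma derivable_oo_LRcontinuous_onem_powR a c : 0 < a ->
  derivable_oo_LRcontinuous (fun y : R => c * (1 - y) `^ a) 0 1.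
Proof.
move=> a0; have dP y : y < 1 -> derivable (fun y : R => (1 - y) `^ a) y 1.
  by move=> y1; have [] := is_derive_onem_powR a y1.
split.
- move=> y; rewrite in_itv/= => /andP[_ y1]; apply: derivableM => //.
  exact: dP.
- apply: cvgM; first exact: cvg_cst.
  apply: cvg_at_right_filter.
  by move: (dP 0 ltr01) => /derivable1_diffP/differentiable_continuous.
- apply: cvgM; first exact: cvg_cst.
  rewrite subrr powR0 ?gt_eqF//.
  exact: cvg_comp cvg_onem_left (powR_cvg0 a0).
Qed.

Lemma is_derive_expRM c y : is_derive y 1 (fun y => expR (c * y)) (c * expR (c * y)).
Proof.
have d1 : is_derive y 1 (fun y : R => c * y) c.
  by apply: is_derive_eq; rewrite /GRing.scale/= mulr1.
by have := is_derive1_comp (is_derive_expR (c * y)) d1; rewrite mulrC.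
Qed.

Lemma continuous_expRM c : continuous (fun y : R => expR (c * y)).
Proof.
by move=> y; have [/derivable1_diffP/differentiable_continuous] := is_derive_expRM c y.
Qed.

Lemma within_continuous_onem_powR a : 0 < a ->
  {within `[0, 1], continuous (fun y : R => (1 - y) `^ a)}.
Proof.
move=> a0; apply: derivable_oo_LRcontinuous_within.
rewrite (_ : (fun y => _) = (fun y => 1 * (1 - y) `^ a)).
  exact: derivable_oo_LRcontinuous_onem_powR.
by apply/funext => y; rewrite mul1r.
Qed.

(** For a > -1 this is M(1, a + 2, -theta) / (a + 1), with M Kummer's confluent hypergeometric
    function. *)
Definition expint (theta a : R) : R :=
  \int[mu]_(x in `[0, 1]) (expR (- theta * x) * (1 - x) `^ a).

Lemma expint_ge0 theta a : 0 <= expint theta a.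
Proof.
by apply: Rintegral_ge0 => x _; rewrite mulr_ge0 ?expR_ge0 ?powR_ge0.
Qed.

Lemma integrable_expint theta a : 0 < a ->
  mu.-integrable `[0, 1] (EFin \o (fun x => expR (- theta * x) * (1 - x) `^ a)).
Proof.
move=> a0; apply: continuous_compact_integrable; first exact: segment_compact.
move=> x; apply: cvgM.
  by apply: continuous_subspaceT => {}x; exact: continuous_expRM.
exact: within_continuous_onem_powR.
Qed.

(** Integration by parts, integrating the power: the boundary term vanishes at 1 and contributes 1 /
    (a + 1) at 0. *)
Lemma expint_rec theta a : 0 < a ->
  (a + 1) * expint theta a = 1 - theta * expint theta (a + 1).
Proof.
move=> a0; have a1 : 0 < a + 1 by rewrite addr_gt0.
have an0 := lt0r_neq0 a1.
rewrite /expint (Rintegration_by_parts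
  (G := fun y => - (a + 1)^-1 * (1 - y) `^ (a + 1))
  (f := fun y => - theta * expR (- theta * y)))//.
- rewrite subrr subr0 powR1 powR0 ?lt0r_neq0// !mulr0 expR0 sub0r mulr1 mul1r opprK.
  under eq_Rintegral => y _.
    rewrite (_ : _ * _ = theta / (a + 1)
      * (expR (- theta * y) * (1 - y) `^ (a + 1))); last first.
      by field.
    over.
  rewrite RintegralZl//; last exact: integrable_expint.
  by field.
- by apply: continuous_subspaceT => x; apply: cvgM;
    [exact: cvg_cst|exact: continuous_expRM].
- split.
  + by move=> x _; have [] := is_derive_expRM (- theta) x.
  + exact/cvg_at_right_filter/continuous_expRM.
  + exact/cvg_at_left_filter/continuous_expRM.
- by move=> x _; rewrite derive1E; have [] := is_derive_expRM (- theta) x.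
- exact: within_continuous_onem_powR.
- exact: derivable_oo_LRcontinuous_onem_powR.
- move=> x; rewrite in_itv/= => /andP[_ x1].
  have := is_derive_onem_powR (a + 1) x1; rewrite addrK => dx.
  have dm := is_deriveM (is_derive_cst (- (a + 1)^-1) x 1) dx.
  rewrite derive1E [LHS](@derive_val _ _ _ _ _ _ _ dm) /GRing.scale/=.
  by field.
Qed.

End ExpIntegral.

(** * The double integral as a series *)

Section DoubleIntegral.
Context {R : realType}.
Local Notation mu := (@lebesgue_measure R).
Implicit Types a x y z theta : R.

(** Induction on [k]: by Pascal's rule, 1 - z times a partial sum of order k + 1 is the one of order
    k minus a boundary term, [t] below. *)
Lemma cvg_negative_binomial (z : R) k : 0 <= z < 1 ->
  series (fun m => 'C(m + k, k)%:R * z ^+ m) @ \oo --> (1 - z)^-1 ^+ k.+1.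
Proof.
move=> /andP[z0 z1]; have z1' : 1 - z != 0 by rewrite subr_eq0 gt_eqF.
have zV : 0 <= (1 - z)^-1 by rewrite invr_ge0 subr_ge0 ltW.
elim: k => [|k IH].
  rewrite expr1 -[X in _ --> X]mul1r.
  have := @cvg_geometric_series R 1 z; rewrite ger0_norm// => /(_ z1).
  rewrite (_ : geometric 1 z = fun m => 'C(m + 0, 0)%:R * z ^+ m)//.
  by apply/funext => m; rewrite addn0 bin0.
pose t m := 'C(m + k, k.+1)%:R * z ^+ m.
set S := series _ in IH; set S1 := series _.
have SE N : S1 N = (1 - z)^-1 * (S N - t N).
  apply: (canRL (mulKf z1')).
  rewrite /S1 /S /series/=; elim: N => [|N IHN].
    by rewrite /t !big_geq// add0n bin_small// mul0r subrr mulr0.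
  rewrite !big_nat_recr//= mulrDr IHN /t addnS addSn binS natrD exprS.
  by ring.
have t_ge0 m : 0 <= t m by rewrite mulr_ge0// exprn_ge0.
have Snd : {homo S1 : m n / (m <= n)%N >-> m <= n}.
  apply/nondecreasing_seqP => N; rewrite /S1 /series/= big_nat_recr//= lerDl.
  by rewrite mulr_ge0// exprn_ge0.
have Sub : has_ubound (range S1).
  have [M [_ SM]] := cvg_seq_bounded (cvgP _ IH).
  exists ((1 - z)^-1 * (M + 1)) => _ [N _ <-].
  rewrite SE ler_wpM2l// (le_trans (y := S N)) ?gerBl//.
  by rewrite (le_trans (ler_norm _))// (SM (M + 1)) ?ltrDl.
(* The monotone bounded sums converge, so their terms tend to 0; these dominate [t], which then
   tends to 0 too. *)
have /cvg_series_cvg_0 t1_0 := nondecreasing_is_cvgn Snd Sub.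
have t_0 : t @ \oo --> 0.
  apply: (squeeze_cvgr _ (cvg_cst 0) t1_0).
  apply: nearW => m; rewrite t_ge0/= ler_wpM2r ?exprn_ge0// ler_nat addnS.
  by rewrite binS leq_addr.
rewrite (_ : S1 = fun N => (1 - z)^-1 * (S N - t N)); last exact/funext.
rewrite exprS -[X in _ * X]subr0; apply: cvgM; first exact: cvg_cst.
exact: cvgB.
Qed.

Lemma cvg_eseries (u : R ^nat) l : series u @ \oo --> l ->
  (\sum_(0 <= m <oo) (u m)%:E = l%:E)%E.
Proof.
move=> ul; apply/cvg_lim => //.
rewrite (_ : (fun _ => _) = EFin \o series u); last first.
  by apply/funext => N /=; rewrite sumEFin.
by apply: cvg_EFin => //; exact: nearW.
Qed.

(** The integrand may be unbounded at 0, so the primitive x^a / a is used on [1/(n+2), 1], followed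
    by monotone convergence. *)
Lemma integral_powR a : 0 < a ->
  (\int[mu]_(x in `[0%R, 1%R]) (x `^ (a - 1))%:E = (a^-1)%:E)%E.
Proof.
move=> a0; rewrite -integral_itv_obnd_cbnd; last first.
  apply/measurable_EFinP; apply: measurable_funTS; exact: measurable_powR.
pose F n := `[n.+2%:R^-1, 1 : R]%classic.
have FU : \bigcup_n F n = `]0, 1]%classic.
  apply/seteqP; split=> x /=.
    move=> [n _]; rewrite /F/= !in_itv/= => /andP[nx ->]; rewrite andbT.
    by rewrite (lt_le_trans _ nx).
  rewrite in_itv/= => /andP[x0 x1].
  have [n nx] : exists n, n.+2%:R^-1 <= x.
    have xV : 0 <= x^-1 by rewrite invr_ge0 ltW.
    exists (Num.truncn x^-1); rewrite invf_ple ?posrE//.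
    by rewrite ltW// (lt_le_trans (truncnS_gt _))// ler_nat.
  by exists n => //; rewrite /F/= in_itv/= nx.
have cvgF : (\int[mu]_(x in F n) (x `^ (a - 1))%:E)%E @[n --> \oo] -->
    (\int[mu]_(x in `]0%R, 1%R]) (x `^ (a - 1))%:E)%E.
  rewrite -FU; apply: ge0_nondecreasing_set_cvg_integral.
  - move=> m n mn; rewrite subsetEset => x; rewrite /F/= !in_itv/=.
    move=> /andP[mx ->]; rewrite andbT (le_trans _ mx)// lef_pV2 ?posrE//.
    by rewrite ler_nat.
  - by move=> n; exact: measurable_itv.
  - move=> n; apply/measurable_EFinP; apply: measurable_funTS.
    exact: measurable_powR.
  - by move=> n x _; rewrite lee_fin powR_ge0.
have intF n : (\int[mu]_(x in F n) (x `^ (a - 1))%:E =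
    ((1 - n.+2%:R^-1 `^ a) / a)%:E)%E.
  have n0 : 0 < n.+2%:R^-1 :> R by rewrite invr_gt0.
  have n1 : n.+2%:R^-1 < 1 :> R by rewrite invf_lt1// ltr1n.
  have dP (x : R) : 0 < x ->
      is_derive x 1 (fun x => a^-1 * x `^ a) (x `^ (a - 1)).
    move=> x0; have dm := is_deriveM (is_derive_cst a^-1 x 1) (is_derive1_powR a x0).
    apply: (@is_derive_eq _ _ _ _ _ _ _ _ dm).
    by rewrite /GRing.scale/= mulr0 addr0 mulKf// gt_eqF.
  have cP (x : R) : 0 < x -> {for x, continuous (fun x => a^-1 * x `^ a)}.
    by move=> x0; have [/derivable1_diffP/differentiable_continuous] := dP x x0.
  rewrite (@continuous_FTC2 _ _ (fun x => a^-1 * x `^ a))//.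
  - by rewrite -EFinB powR1; congr _%:E; rewrite -mulrBr mulrC.
  - apply: derivable_within_continuous => x; rewrite in_itv/= => /andP[nx _].
    by have [] := is_derive1_powR (a - 1) (lt_le_trans n0 nx).
  - split.
    + move=> x; rewrite in_itv/= => /andP[nx _].
      by have [] := dP x (lt_trans n0 nx).
    + exact/cvg_at_right_filter/cP.
    + exact/cvg_at_left_filter/cP.
  - move=> x; rewrite in_itv/= => /andP[nx _].
    by rewrite derive1E; have [] := dP x (lt_trans n0 nx).
have lim : ((1 - n.+2%:R^-1 `^ a) / a) @[n --> \oo] --> (1 - 0) / a.
  apply: cvgM; last exact: cvg_cst.
  apply: cvgB; first exact: cvg_cst.
  have /cvg_at_rightP := powR_cvg0 a0; apply; split.
    by move=> n; rewrite invr_gt0.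
  have := @cvg_harmonic R; rewrite -(cvg_shiftn 1).
  by under eq_fun do rewrite /= addn1.
rewrite subr0 mul1r in lim.
have /(cvg_unique (@ereal_hausdorff R)) uniqF := cvgF; apply: uniqF => /=.
under eq_fun do rewrite intF.
by apply: cvg_EFin => //; exact: nearW.
Qed.

(** At [x = 0] the exponent law needs a nonzero total exponent, which [0 < b + 1] ensures for
    [m >= 1]. *)
Lemma powR_mulX (x b : R) m : 0 <= x -> 0 < b + 1 ->
  x `^ b * x ^+ m = x `^ (b + m%:R).
Proof.
case: m => [|m] x0 b1; first by rewrite expr0 mulr1 addr0.
rewrite -powR_mulrn// powRD// gt_eqF//.
by rewrite (lt_le_trans b1)// lerD2l ler1n.
Qed.

Lemma measurable_powR_onemX (a : R) k (D : set R) :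
  measurable_fun D (fun x => x `^ a * (1 - x) ^+ k).
Proof.
apply: measurable_funTS; apply: measurable_funM; first exact: measurable_powR.
by apply: measurable_funX; exact: measurable_funB.
Qed.

(** The Beta integral B(a, k + 1). Splitting 1 = (1 - x) + x gives I(a, k) = I(a, k + 1) + I(a + 1,
    k), which determines I(a, k + 1). *)
Lemma integral_beta a k : 0 < a ->
  (\int[mu]_(x in `[0%R, 1%R]) (x `^ (a - 1) * (1 - x) ^+ k)%:E =
   (k`!%:R / rising a k.+1)%:E)%E.
Proof.
elim: k a => [|k IH] a a0.
  rewrite risingS rising0 mulr1 fact0 mul1r -integral_powR//.
  by apply: eq_integral => x _; rewrite expr0 mulr1.
have a1 : 0 < a + 1 by rewrite addr_gt0.
have := IH _ a0; rewrite (_ : (\int[mu]_(x in _) _)%E =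
    (\int[mu]_(x in `[0%R, 1%R]) (x `^ (a - 1) * (1 - x) ^+ k.+1)%:E
     + \int[mu]_(x in `[0%R, 1%R]) (x `^ (a + 1 - 1) * (1 - x) ^+ k)%:E)%E); last first.
  rewrite -ge0_integralD//.
  - apply: eq_integral => x; rewrite inE/= in_itv/= => /andP[x0 x1].
    rewrite -EFinD; congr _%:E.
    have -> : x `^ (a + 1 - 1) = x `^ (a - 1) * x.
      by rewrite -[X in _ = _ * X]expr1 powR_mulX ?subrK// addrK.
    by rewrite exprS; ring.
  - move=> x; rewrite /= in_itv/= => /andP[x0 x1].
    by rewrite lee_fin mulr_ge0 ?powR_ge0 ?exprn_ge0 ?subr_ge0.
  - by apply/measurable_EFinP; exact: measurable_powR_onemX.
  - move=> x; rewrite /= in_itv/= => /andP[x0 x1].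
    by rewrite lee_fin mulr_ge0 ?powR_ge0 ?exprn_ge0 ?subr_ge0.
  - by apply/measurable_EFinP; exact: measurable_powR_onemX.
(* An infinite value of the unknown integral would make the finite total infinite. *)
rewrite (IH _ a1); case: (\int[mu]_(x in _) _)%E => [X| |]//.
move=> XE; have {}XE := EFin_inj XE; congr _%:E.
rewrite -[X](addrK (k`!%:R / rising (a + 1) k.+1)) XE.
rewrite (risingS a k.+1) (risingS a k).
have rk := rising_gt0 k a1.
have ak : 0 < a + 1 + k%:R by rewrite ltr_wpDr.
rewrite (risingSr (a + 1) k) factS natrM.
field.
by rewrite (lt0r_neq0 a0) (lt0r_neq0 rk) (lt0r_neq0 ak).
Qed.

(** The m-th negative binomial coefficient times its Beta integral is the closed form of g_r, with j
    = k + 2 and r = m + 1. *)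
Lemma gap_rate_binomial theta k m : 0 < theta ->
  theta ^+ 2 * 'C(m + k, k)%:R * (k`!%:R / rising (theta + m%:R) k.+1) =
  gap_rate theta k.+2 m.+1 * theta.
Proof.
move=> theta0; rewrite /gap_rate.
have -> : (k.+2%:Z - 2 = k)%R by lia.
have -> : (k.+2%:Z - 1 = k.+1)%R by lia.
rewrite rising_fact subn1/=.
have -> : (m + k)`!%:R = 'C(m + k, k)%:R * (k`!%:R * m`!%:R) :> R.
  by rewrite -!natrM -(@bin_fact (m + k) k) ?leq_addl// addnK.
have m0 : 0 < m`!%:R :> R by rewrite ltr0n fact_gt0.
have r0 := rising_gt0 k.+1 (ltr_wpDr (ler0n R m) theta0).
by field; rewrite (lt0r_neq0 m0) (lt0r_neq0 r0).
Qed.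

(** Expand in powers of x (1 - y), which [0 < y] keeps below 1 even at x = 1, and integrate termwise
    by nonnegativity. *)
Lemma inner_integral theta k y : 0 < theta -> 0 < y <= 1 ->
  (\int[mu]_(x in `[0%R, 1%R])
     (theta ^+ 2 * expR (- theta * y) * x `^ (theta - 1) * (1 - x) ^+ k
        * (1 - y) `^ (theta + k.+2%:R - 1) / (1 - x + x * y) ^+ k.+1)%:E =
   \sum_(0 <= m <oo) (gap_rate theta k.+2 m.+1 * theta
     * (expR (- theta * y) * (1 - y) `^ (theta + k.+2%:R - 1 + m%:R)))%:E)%E.
Proof.
move=> theta0 /andP[y0 y1].
pose D m := theta ^+ 2 * 'C(m + k, k)%:R
  * (expR (- theta * y) * (1 - y) `^ (theta + k.+2%:R - 1 + m%:R)).
have D0 m : 0 <= D m.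
  by rewrite !mulr_ge0 ?exprn_ge0 ?(ltW theta0) ?expR_ge0 ?powR_ge0.
have B0 m (x : R) : `[0, 1]%classic x ->
    0 <= x `^ (theta + m%:R - 1) * (1 - x) ^+ k.
  rewrite /= in_itv/= => /andP[x0 x1].
  by rewrite mulr_ge0 ?powR_ge0 ?exprn_ge0 ?subr_ge0.
transitivity (\int[mu]_(x in `[0%R, 1%R]) (\sum_(0 <= m <oo)
    (D m * (x `^ (theta + m%:R - 1) * (1 - x) ^+ k))%:E))%E.
  apply: eq_integral => x; rewrite inE/= in_itv/= => /andP[x0 x1].
  apply/esym/cvg_eseries.
  set K := theta ^+ 2 * expR (- theta * y) * x `^ (theta - 1) * (1 - x) ^+ k
    * (1 - y) `^ (theta + k.+2%:R - 1).
  have z01 : 0 <= x * (1 - y) < 1.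
    rewrite mulr_ge0 ?subr_ge0//= (le_lt_trans (y := 1 - y))//.
      by rewrite ler_piMl ?subr_ge0.
    by rewrite ltrBlDr ltrDl.
  have -> : 1 - x + x * y = 1 - x * (1 - y) by ring.
  rewrite -exprVn.
  rewrite (_ : series _ = (fun=> K)
      \* series (fun m => 'C(m + k, k)%:R * (x * (1 - y)) ^+ m)).
    exact: cvgM (cvg_cst K) (cvg_negative_binomial z01).
  apply/funext => N; rewrite /series/= mulr_sumr; apply: eq_bigr => m _.
  rewrite /D /K (_ : theta + m%:R - 1 = theta - 1 + m%:R); last by ring.
  rewrite -!powR_mulX ?subr_ge0 ?subrK ?exprMn//; last first.
    by rewrite ltr_wpDr.
  by ring.
rewrite integral_nneseries//; last 2 first.
- move=> m; apply/measurable_EFinP; apply: measurable_funM => //.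
  exact: measurable_powR_onemX.
- by move=> m x x01; rewrite lee_fin mulr_ge0// B0.
apply: eq_eseriesr => m _.
under eq_integral do rewrite EFinM.
rewrite ge0_integralZl_EFin//; last 2 first.
- by move=> x x01; rewrite lee_fin B0.
- by apply/measurable_EFinP; exact: measurable_powR_onemX.
rewrite integral_beta; last by rewrite ltr_wpDr.
rewrite -EFinM; congr _%:E; rewrite /D -gap_rate_binomial//.
by ring.
Qed.


Lemma gap_rate_ge0 theta j r : 0 < theta -> (0 < r)%N -> 0 <= gap_rate theta j r.
Proof.
move=> theta0 r0; have tr : 0 < theta + (r - 1)%:R by rewrite ltr_wpDr.
rewrite /gap_rate !mulr_ge0 ?invr_ge0// ltW// rising_gt0//.
by rewrite ltr0n.
Qed.

(** Termwise integration in y of the previous series. The point y = 0, which it does not cover, is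
    dropped as a null set. *)
Lemma double_integral theta j : 0 < theta -> (2 <= j)%N ->
  (\int[mu]_(y in `[0%R, 1%R]) \int[mu]_(x in `[0%R, 1%R])
     (theta ^+ 2 * expR (- theta * y) * x `^ (theta - 1)
        * (1 - x) ^+ (j - 2) * (1 - y) `^ (theta + j%:R - 1)
        / (1 - x + x * y) ^+ (j - 1))%:E =
   \sum_(0 <= m <oo) (gap_rate theta j m.+1
      * (theta * expint theta (theta + j%:R - 1 + m%:R)))%:E)%E.
Proof.
case: j => [|[|k]]// theta0 _; rewrite subSS subSS subn0 subn1 [k.+2.-1]/=.
set b := theta + k.+2%:R - 1.
have b0 m : 0 < b + m%:R.
  by rewrite ltr_wpDr// /b -natr1 addrA addrK ltr_wpDr.
pose e m y := expR (- theta * y) * (1 - y) `^ (b + m%:R).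
pose f m y := (gap_rate theta k.+2 m.+1 * theta * e m y)%:E.
have c0 m : 0 <= gap_rate theta k.+2 m.+1 * theta.
  by rewrite mulr_ge0 ?gap_rate_ge0// ltW.
have f0 m y : (0 <= f m y)%E.
  by rewrite lee_fin mulr_ge0// mulr_ge0 ?expR_ge0 ?powR_ge0.
have me m D : measurable_fun D (e m).
  apply: measurable_funTS; apply: measurable_funM.
    apply: measurableT_comp; first exact: measurable_expR.
    exact: measurable_funM.
  apply: (measurableT_comp (measurable_powR _)); exact: measurable_funB.
have mf m D : measurable_fun D (f m).
  by apply/measurable_EFinP; apply: measurable_funM.
have innerE y : y \in `]0%R, 1%R]%classic ->
  (\sum_(0 <= m <oo) f m y = \int[mu]_(x in `[0%R, 1%R])
     (theta ^+ 2 * expR (- theta * y) * x `^ (theta - 1)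
        * (1 - x) ^+ k * (1 - y) `^ b / (1 - x + x * y) ^+ k.+1)%:E)%E.
  by rewrite inE/= in_itv/= => y01; rewrite inner_integral.
(* Dropping the end point requires measurability of the inner integral in y, inherited from the
   series. *)
rewrite -integral_itv_obnd_cbnd; last first.
  apply: eq_measurable_fun innerE _.
  by apply: ge0_emeasurable_sum => // m y _ _.
transitivity (\int[mu]_(y in `]0%R, 1%R]) \sum_(0 <= m <oo) f m y)%E.
  by apply: eq_integral => y /innerE ->.
rewrite integral_nneseries//; last by move=> m; exact: mf.
apply: eq_eseriesr => m _; rewrite integral_itv_obnd_cbnd/f; last exact: mf.
under eq_integral do rewrite EFinM.
rewrite ge0_integralZl_EFin//; last 2 first.
- by move=> y _; rewrite lee_fin mulr_ge0 ?expR_ge0 ?powR_ge0.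
- by apply/measurable_EFinP; exact: me.
rewrite mulrA [in RHS]EFinM; congr (_ * _)%E.
rewrite /expint /Rintegral fineK//.
by apply: integrable_fin_num => //; exact: integrable_expint.
Qed.

End DoubleIntegral.

(** * Limit *)

Section Limit.
Context {R : realType} (theta : R).
Hypothesis theta_gt0 : 0 < theta.
Implicit Types a : R.

(* The limit w_r of P(eta_r = 1) is chainlim (theta + r - 1). *)
Definition chainlim (a : R) : R := theta * expint theta (a - 1).

Lemma chainlim_ge0 a : 0 <= chainlim a.
Proof. by rewrite mulr_ge0 ?expint_ge0// ltW. Qed.

Lemma chainlim_rec a : 1 < a ->
  chainlim a = theta / a * (1 - chainlim (a + 1)).
Proof.
move=> a1; have := @expint_rec R theta (a - 1); rewrite subr_gt0 => /(_ a1).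
rewrite subrK /chainlim addrK => <-.
by field; rewrite gt_eqF// (lt_trans ltr01).
Qed.

Lemma chainlim_le a : 1 < a -> chainlim a <= theta / a.
Proof.
move=> a1; rewrite chainlim_rec// ler_piMr ?gerBl ?chainlim_ge0//.
by rewrite divr_ge0// ltW// (lt_trans ltr01).
Qed.

(** Both sides obey one recursion, so each step multiplies the error by a factor theta / a, at most
    1 since [theta <= a]. The first factor is kept for summability in r, the last for decay in n. *)
Lemma altsum_chainlim m a : (0 < m)%N -> 1 < a -> theta <= a ->
  `|altsum theta m a - chainlim a| <= theta / a * (theta / (a + m%:R)).
Proof.
case: m => // m _; elim: m a => [|m IH] a a1 ta.
  have a0 : 0 < a by rewrite (lt_trans ltr01).
  rewrite altsumS// altsum0 chainlim_rec// -mulrBr subr0 opprB addrC subrK.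
  have a1' : 1 < a + 1 by rewrite ltrDr.
  have ta0 : 0 <= theta / a by rewrite ltW// divr_gt0.
  rewrite ger0_norm ?(mulr_ge0 ta0 (chainlim_ge0 _))// ler_wpM2l//.
  exact: chainlim_le.
have a0 : 0 < a by rewrite (lt_trans ltr01).
rewrite altsumS// chainlim_rec// -mulrBr opprB addrC addrA subrK normrM distrC.
have ta0 : 0 <= theta / a by rewrite ltW// divr_gt0.
rewrite (ger0_norm ta0) ler_wpM2l//.
have a1' : 1 < a + 1 by rewrite ltrDr.
have ta' : theta <= a + 1 by rewrite (le_trans ta)// lerDl.
rewrite (le_trans (IH _ a1' ta'))// -addrA nat1r.
apply: ler_piMl; first by rewrite ltW// divr_gt0// ltr_wpDr.
by rewrite ler_pdivrMr ?mul1r// (lt_trans ltr01).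
Qed.

Lemma gap_rate_le j r : (2 <= j)%N -> (0 < r)%N ->
  gap_rate theta j r <= theta / (theta + (r - 1)%:R).
Proof.
case: j r => [|[|k]]// [|r]// _ _; rewrite /gap_rate subn1 [r.+1.-1]/=.
have -> : (k.+2%:Z - 2 = k)%R by lia.
have -> : (k.+2%:Z - 1 = k.+1)%R by lia.
have tr : 0 < theta + r%:R by rewrite ltr_wpDr.
have tr1 : 0 < theta + r%:R + 1 by rewrite addr_gt0.
have rk := rising_gt0 k tr1.
have -> : theta * rising r.+1%:R k / rising (theta + r%:R) k.+1 =
    theta / (theta + r%:R) * (rising r.+1%:R k / rising (theta + r%:R + 1) k).
  by rewrite risingS; field; rewrite (lt0r_neq0 rk) (lt0r_neq0 tr).
apply: ler_piMr; first by rewrite ltW// divr_gt0.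
rewrite ler_pdivrMr// mul1r le_rising//.
by rewrite -natr1 lerD2r lerDr ltW.
Qed.

(** Telescoping: 1 / ((theta + r - 1)(theta + r)) is a difference of consecutive reciprocals. *)
Lemma sum_pair_le M : 
  \sum_(3 <= r < M + 3) theta / (theta + (r - 1)%:R) * (theta / (theta + r%:R))
  <= theta.
Proof.
have -> : \sum_(3 <= r < M + 3)
    theta / (theta + (r - 1)%:R) * (theta / (theta + r%:R)) =
    theta ^+ 2 * ((theta + 2)^-1 - (theta + (M + 2)%:R)^-1).
  elim: M => [|M IH]; first by rewrite big_geq// subrr mulr0.
  rewrite addSn big_nat_recr/=; last by rewrite leq_addl.
  rewrite IH; have -> : (M + 3 - 1 = M + 2)%N by lia.
  have -> : (M.+1 + 2 = M + 3)%N by lia.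
  have t0 m : theta + m%:R != 0 by rewrite gt_eqF// ltr_wpDr.
  have := (t0 2%N, t0 (M + 2)%N, t0 (M + 3)%N); rewrite !natrD.
  by move=> [[n2 n3] n4]; field; apply/and3P; split; rewrite // -?addrA// addrC.
have t2 : 0 < theta + 2 by rewrite addr_gt0.
apply: (@le_trans _ _ (theta ^+ 2 * (theta + 2)^-1)).
  by rewrite ler_wpM2l ?exprn_ge0 ?(ltW theta_gt0)// gerBl invr_ge0 addr_ge0// ltW.
by rewrite ler_pdivrMr// expr2 ler_wpM2l ?(ltW theta_gt0)// lerDl.
Qed.

(** The left side corrects the terms [r = 1, 2] of the full series. For [j = 2] the two [r = 1]
    terms cancel; for [j >= 3] the recursion of [chainlim] reduces everything to one integral. *)
Lemma limit_const j : (2 <= j)%N ->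
  gap theta j 1 * chainlim (theta + j%:R)
  - gap_rate theta j 1 * chainlim (theta + j%:R)
  - gap_rate theta j 2 * chainlim (theta + j%:R + 1) =
  (3 <= j)%N%:R * (theta ^+ 3 * ((j - 2)`!)%:R / rising theta (j%:Z + 1)
     * (theta + j%:R - 1 - ((theta + j%:R - 1) ^+ 2 + j%:R - 1)
        * expint theta (theta + j%:R)))
  - (j == 2%N)%:R * (theta ^+ 2 / (theta + 1) * expint theta (theta + 2)).
Proof.
move=> j2; have t0 := theta_gt0; rewrite (gap1 theta_gt0 j2).
case: j j2 => [|[|[|k]]] j2; [discriminate j2|discriminate j2| |].
  rewrite mul0r sub0r mul1r /gap_rate /chainlim addrK.
  have -> : (2%:Z - 3 = Negz 0)%R by lia.
  have -> : (2%:Z - 2 = 0%N)%R by lia.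
  have -> : (2%:Z - 1 = 1%N)%R by lia.
  rewrite !risingS !rising0 subnn addr0 [rising _ (Negz 0)]/rising.
  have t1 : 0 < theta + 1 by rewrite addr_gt0.
  rewrite eqxx mul1r -[(2 - 1)%N]/1%N.
  by field; rewrite (lt0r_neq0 t0) (lt0r_neq0 t1).
rewrite mul1r mul0r subr0.
rewrite chainlim_rec; last first.
  by rewrite -[X in X < _]add0r ltrD// ltr1n.
rewrite /gap_rate subnn addr0 /chainlim addrK.
have -> : (k.+3%:Z - 3 = k)%R by lia.
have -> : (k.+3%:Z - 2 = k.+1)%R by lia.
have -> : (k.+3%:Z - 1 = k.+2)%R by lia.
have -> : (k.+3%:Z + 1 = k.+4)%R by lia.
have -> : (k.+3 - 2 = k.+1)%N by lia.
rewrite (rising_fact 0) (rising_fact 1) fact0 !divr1 add0n add1n [k.+2`!]factS.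
rewrite -[(2 - 1)%N]/1%N !(risingS theta) !(risingS (theta + 1)).
have -> : theta + 1 + 1 = theta + 2 by rewrite -addrA.
rewrite !(risingSr (theta + 2)) natrM -[k.+3]addn3 natrD.
have t1 : 0 < theta + 1 by rewrite addr_gt0.
have t2 : 0 < theta + 2 by rewrite addr_gt0.
have rk := rising_gt0 k t2.
have -> : k.+2%:R = k%:R + 2 :> R by rewrite -addn2 natrD.
have -> : k.+1%:R = k%:R + 1 :> R by rewrite -addn1 natrD.
have t2k : 0 < theta + 2 + k%:R by rewrite ltr_wpDr.
have t3k : 0 < theta + (k%:R + 3) by rewrite ltr_wpDr// addr_ge0.
have t3k' : 0 < theta + 2 + (k%:R + 1) by rewrite ltr_wpDr// addr_ge0.
field.
by rewrite (lt0r_neq0 t3k') (lt0r_neq0 t2k) (lt0r_neq0 rk) (lt0r_neq0 t1)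
  (lt0r_neq0 t0).
Qed.

Lemma harmonic_bound N x : x >= (N + 1)%:R -> theta / x <= theta * harmonic N.
Proof.
move=> Nx; rewrite ler_wpM2l ?(ltW theta_gt0)// /harmonic/= -addn1.
have N0 : 0 < (N + 1)%:R :> R by rewrite ltr0n addn1.
by rewrite lef_pV2 ?posrE// (lt_le_trans N0).
Qed.

(** The expectation is a partial sum of the nonnegative series, plus the correction of its first two
    terms, plus an error of order 1 / n. *)
Lemma cvg_expectation (d : nat -> measure_display)
    (T : forall n, measurableType (d n)) (P : forall n, probability (T n) R)
    (eta : forall n, nat -> {RV (P n) >-> bool}) j :
  (forall n : nat, (2 <= n)%N -> playground (eta n) theta n) -> (2 <= j)%N ->
  ('E_(P n)[Ceta (eta n) n j])%E @[n --> \oo] -->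
  (\sum_(0 <= m <oo) (gap_rate theta j m.+1
      * (theta * expint theta (theta + j%:R - 1 + m%:R)))%:E
   + (gap theta j 1 * chainlim (theta + j%:R)
      - gap_rate theta j 1 * chainlim (theta + j%:R)
      - gap_rate theta j 2 * chainlim (theta + j%:R + 1))%:E)%E.
Proof.
move=> Hp j2; set w := fun r => chainlim (theta + (r + j - 1)%:R).
set c := gap theta j 1 * _ - _ - _.
have t0 := ltW theta_gt0.
have j1 (r : nat) : (0 < r)%N -> 1 < theta + (r + j - 1)%:R.
  by move=> r0; rewrite -[X in X < _]add0r ltr_leD// ler1n; lia.
(* With n = N + j + 3, the error consists of the topmost position and the differences between
   [altsum] and its limit. *)
pose del N := gap_rate theta j (N + 4)
  + gap theta j 1 * (altsum theta (N + 2) (theta + j%:R) - w 1%N)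
  + \sum_(3 <= r < N + 3) gap_rate theta j r *
      (altsum theta (N + 3 - r) (theta + (r + j - 1)%:R) - w r).
have EC N : 'E_(P (N + (j + 3))%N)[Ceta (eta (N + (j + 3))%N) (N + (j + 3)) j]%E =
  ((\sum_(0 <= m < N + 2) gap_rate theta j m.+1 * w m.+1) + (c + del N))%:E.
  rewrite (expectation_gap_sum theta_gt0 _ (Hp _ _)); [|lia..].
  congr _%:E.
  have -> : (N + (j + 3) - j = N + 3)%N by lia.
  rewrite addn2 big_nat_recl// big_nat_recl//.
  have -> : (N + 3 + 1 = N + 4)%N by lia.
  have -> : (N + 3 - 1 = N + 2)%N by lia.
  have -> : \sum_(3 <= r < N + 3) gap_rate theta j r *
      altsum theta (N + (j + 3) - (r + j)) (theta + (r + j - 1)%:R) =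
    \sum_(0 <= m < N) gap_rate theta j m.+3 * w m.+3 +
    \sum_(3 <= r < N + 3) gap_rate theta j r *
      (altsum theta (N + 3 - r) (theta + (r + j - 1)%:R) - w r).
    have <- : \sum_(3 <= r < N + 3) gap_rate theta j r * w r =
        \sum_(0 <= m < N) gap_rate theta j m.+3 * w m.+3.
      rewrite -{1}[3%N]add0n big_addn addnK.
      by apply: eq_bigr => m _; rewrite addn3.
    rewrite -big_split/=; apply: eq_big_nat => r /andP[r3 rN].
    have -> : (N + (j + 3) - (r + j) = N + 3 - r)%N by lia.
    by ring.
  rewrite /del /c.
  have -> : theta + j%:R = theta + (1 + j - 1)%:R by congr (_ + _%:R); lia.
  have -> : theta + (1 + j - 1)%:R + 1 = theta + (2 + j - 1)%:R.
    by rewrite -addrA natr1; congr (_ + _%:R); lia.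
  rewrite -/(w 1%N) -/(w 2%N).
  ring.
have harm N (r : nat) : (N < r)%N -> theta / (theta + r%:R) <= theta * harmonic N.
  move=> Nr; apply: harmonic_bound; rewrite -[X in X <= _]add0r lerD// ler_nat.
  by rewrite addn1.
have delb N : `|del N| <= (theta + gap theta j 1 * theta + theta ^+ 2) * harmonic N.
  have g0 : 0 <= gap theta j 1.
    by rewrite gap1// divr_ge0// ltW// rising_gt0// addr_gt0.
  have h0 : 0 <= theta * harmonic N :> R by rewrite mulr_ge0// invr_ge0.
  have frac_ge0 (r : nat) : 0 <= theta / (theta + r%:R).
    by rewrite divr_ge0// addr_ge0.
  have alt (m r : nat) : (0 < m)%N -> (0 < r)%N -> (N < r + j - 1 + m)%N ->
      `|altsum theta m (theta + (r + j - 1)%:R) - w r|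
      <= theta / (theta + (r + j - 1)%:R) * (theta * harmonic N).
    move=> m0 r0 Nm; rewrite (le_trans (altsum_chainlim m0 (j1 r r0) _))//.
      by rewrite lerDl.
    by rewrite ler_wpM2l// -addrA -natrD harm.
  rewrite !mulrDl (le_trans (ler_normD _ _))// lerD//.
    rewrite (le_trans (ler_normD _ _))// lerD//.
      rewrite ger0_norm; last by rewrite gap_rate_ge0// addn4.
      rewrite (le_trans (gap_rate_le j2 _)) ?addn4// harm// subn1/=; lia.
    rewrite normrM ger0_norm// -mulrA ler_wpM2l//.
    have -> : theta + j%:R = theta + (1 + j - 1)%:R by congr (_ + _%:R); lia.
    rewrite (le_trans (alt _ _ _ _ _))//; [lia..|].
    apply: ler_piMl => //.
    by rewrite ler_pdivrMr ?mul1r ?lerDl// ltr_wpDr.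
  rewrite (le_trans (ler_norm_sum _ _ _))//.
  (* Bounding theta / (theta + r + j - 1) by theta / (theta + r) gives the telescoping sum, bounded
     uniformly in N. *)
  apply: (@le_trans _ _ ((\sum_(3 <= r < N + 3)
      theta / (theta + (r - 1)%:R) * (theta / (theta + r%:R)))
        * (theta * harmonic N))); last first.
    by rewrite expr2 -mulrA ler_wpM2r// sum_pair_le.
  rewrite mulr_suml; apply: ler_sum_nat => r /andP[r3 rN].
  rewrite normrM ger0_norm; last by rewrite gap_rate_ge0//; lia.
  rewrite -mulrA ler_pM ?gap_rate_ge0 ?gap_rate_le//; [lia..|].
  rewrite (le_trans (alt _ _ _ _ _))//; [lia..|].
  rewrite ler_wpM2r// ler_wpM2l// lef_pV2 ?posrE ?ltr_wpDr//.
  by rewrite lerD2l ler_nat; lia.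
have del0 : del @ \oo --> 0.
  set C := theta + gap theta j 1 * theta + theta ^+ 2 in delb.
  have bnd0 : (C * harmonic N) @[N --> \oo] --> (0 : R).
    rewrite -[0 in X in _ --> X](mulr0 C).
    by apply: cvgM; [exact: cvg_cst|exact: cvg_harmonic].
  apply/norm_cvg0P; apply: (squeeze_cvgr _ _ bnd0); last exact: cvg_cst.
  by apply: nearW => N /=; rewrite normr_ge0 delb.
rewrite -(cvg_shiftn (j + 3)).
under eq_fun do rewrite EC EFinD.
apply: cvgeD.
(* As [c] is finite, the sum of the limits is defined whatever the value of the series. *)
- exact: fin_num_adde_defl.
- set v := fun m => (gap_rate theta j m.+1
      * (theta * expint theta (theta + j%:R - 1 + m%:R)))%:E.
  have v0 m : (0 <= m)%N -> true -> (0 <= v m)%E.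
    by rewrite lee_fin mulr_ge0 ?gap_rate_ge0// mulr_ge0// expint_ge0.
  have := is_cvg_nneseries v0; rewrite -(cvg_shiftn 2).
  rewrite (_ : [sequence _]_n =
    (fun N => (\sum_(0 <= m < N + 2) gap_rate theta j m.+1 * w m.+1)%:E))//.
  apply/funext => N /=; rewrite -sumEFin; apply: eq_bigr => m _.
  rewrite /v /w /chainlim; congr (_ * (_ * expint _ _))%:E.
  by rewrite addSn subn1/= natrD; ring.
- apply: cvg_EFin; first exact: nearW.
  rewrite -[X in _ --> X]addr0; apply: cvgD => //; exact: cvg_cst.
Qed.

End Limit.

Theorem theorem2 (R : realType) (theta : R) (theta_gt0 : 0 < theta) :
  (forall (d : measure_display) (T : measurableType d) (P : probability T R)
          (eta : nat -> {RV P >-> bool}) (n : nat),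
     (2 <= n)%N -> playground eta theta n ->
     [/\ forall j : nat, (2 <= j <= n - 2)%N ->
           'E_P[Ceta eta n j]%E =
           (theta * rising (n - j + 1)%N%:R (j%:Z - 2)
              / rising (theta + (n - j)%N%:R) (j%:Z - 1)
            + \sum_(1 <= k < n - j)
                (-1) ^+ k.+1 * theta ^+ k * ((j - 2)`!)%:R
                  / (rising (theta + 2) (j%:Z - 3)
                     * rising (theta + j%:R) k%:Z)
            + \sum_(j + 3 <= i < n) \sum_(1 <= k < (n - i).+1)
                (- theta) ^+ k.+1 * rising (i - j)%N%:R (j%:Z - 2)
                  / (rising (theta + (i - j - 1)%N%:R) (j%:Z - 1)
                     * rising (theta + (i - 1)%N%:R) k%:Z))%:E,
         'E_P[Ceta eta n n]%E =
           (((n - 2)`!)%:R / rising (theta + 2) (n%:Z - 3))%:E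
       & 'E_P[Ceta eta n (n - 1)]%E = 0%:E])
  /\
  (forall (d : nat -> measure_display) (T : forall n, measurableType (d n))
          (P : forall n, probability (T n) R)
          (eta : forall n, nat -> {RV (P n) >-> bool}),
     (forall n : nat, (2 <= n)%N -> playground (eta n) theta n) ->
     forall j : nat, (2 <= j)%N ->
     ('E_(P n)[Ceta (eta n) n j])%E @[n --> \oo] -->
       ((\int[lebesgue_measure]_(y in `[0%R, 1%R])
          \int[lebesgue_measure]_(x in `[0%R, 1%R])
            (theta ^+ 2 * expR (- theta * y) * x `^ (theta - 1)
               * (1 - x) ^+ (j - 2) * (1 - y) `^ (theta + j%:R - 1)
               / (1 - x + x * y) ^+ (j - 1))%R%:E)
        + ((3 <= j)%N%:R * (theta ^+ 3 * ((j - 2)`!)%:R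
               / rising theta (j%:Z + 1)
             * (theta + j%:R - 1
                - ((theta + j%:R - 1) ^+ 2 + j%:R - 1)
                  * \int[lebesgue_measure]_(x in `[0, 1])
                      (expR (- theta * x) * (1 - x) `^ (theta + j%:R))))
           - (j == 2%N)%:R * (theta ^+ 2 / (theta + 1)
             * \int[lebesgue_measure]_(x in `[0, 1])
                 (expR (- theta * x) * (1 - x) `^ (theta + 2))))%R%:E)%E).
Proof.
split=> [d T P eta n n2 Hp|d T P eta Hp j j2].
  split; first by move=> j jn; exact: (expectation_explicit theta_gt0 n2 Hp jn).
    exact: (expectation_full theta_gt0 n2 Hp).
  exact: (expectation_none theta_gt0 n2 Hp).
rewrite double_integral// -limit_const//.
exact: cvg_expectation.
Qed.
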